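(* Let $k \ge 2$ be an integer and $q$ a prime power, both fixed, and let $p = \mathrm{char}(\mathbb F_q)$. Write the base-$p$ representation of $k$ as $k = dp^a + \dots + d_1 p + d_0$ with $0 \le d = d_a, \dots, d_1, d_0 < p$ and $d \neq 0$, and set $\theta = 1 - (p-d+1)p^{-a-1}$. If $n$ is sufficiently large and $F$ is a monic polynomial in $\mathbb F_q[x]$ of degree $n$, then the interval $\mathcal I_q(F,h)$ contains a $k$-free polynomial whenever \[ q^{h+1} > \left( \frac{n}{\log_q n}\right)^{1/\theta}. \]
   Context: $\mathbb F_q$ denotes the finite field with $q$ elements. For $F \in \mathbb F_q[x]$ and an integer $h$, $\mathcal I_q(F,h) = \{ Q \in \mathbb F_q[x] : \deg(F-Q) \le h\}$. A polynomial in $\mathbb F_q[x]$ is $k$-free if it is not divisible by the $k$th power of any non-constant polynomial. *)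

(* Defs.v *)
From HB Require Import structures.
From mathcomp Require Import all_boot all_order all_algebra.
From mathcomp Require Import boolp classical_sets reals exp.

Set Implicit Arguments.
Unset Strict Implicit.
Unset Printing Implicit Defensive.

Import Order.TTheory GRing.Theory Num.Theory.

Local Open Scope ring_scope.
Local Open Scope classical_set_scope.

(* deg P <= h for an arbitrary integer h, with deg 0 = -oo. *)
Definition deg_le (K : fieldType) (P : {poly K}) (h : int) : Prop :=
  P = 0 \/ ((size P).-1%:Z <= h).

Definition short_interval (K : fieldType) (F : {poly K}) (h : int) :
    set {poly K} :=
  [set Q | deg_le (F - Q) h].

(* In particular 0 is not k-free. *)
Definition kfree (K : fieldType) (k : nat) (Q : {poly K}) : Prop :=
  forall P : {poly K}, (1 < size P)%N -> ~~ (P ^+ k %| Q).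

Definition base_repr (p k a : nat) (d : nat -> nat) : Prop :=
  [/\ k = (\sum_(0 <= i < a.+1) d i * p ^ i)%N,
      forall i, (i <= a)%N -> (d i < p)%N
    & d a != 0%N].

(* The exponent attached to the leading base-p digit d of k, of weight p ^ a. *)
Definition theta (R : realType) (p d a : nat) : R :=
  1 - (p%:R - d%:R + 1) / p%:R ^+ a.+1.

Definition logb (R : realType) (b x : R) : R := ln x / ln b.

(* Main.v *)
(**
Put s = p^a, N = h + 1 and H = q^N, and let Q = F + G run over the H members
of the interval.  If Q is not k-free then P^k divides Q for some monic
irreducible P, and we bound the number of such Q according to deg P.

For deg P <= N - C the union bound over P gives at most (S + O(q^-C)) H, with
S = 1 / (q^(k-1) - 1), lowered to 5/8 when q = k = 2.

For deg P > N - C, write D Q for the (d-1)-st derivative of the polynomial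
formed by the coefficients of Q at the exponents congruent to -1 mod s.  Up to
s-th roots of the coefficients this is the Hasse derivative of order d s - 1.
Since P^(d s) divides Q, the Frobenius twist P^phi of P, characterized by
P^s = P^phi(X^s), divides D Q.  As Q varies, D Q takes at most H^(1-theta)
values; the value 0 occurs for at most q^(N-C) of the Q, and a nonzero value
has degree at most n/s, hence at most n / (s (N - C)) divisors P^phi.  Because
H^theta > n / log_q n and N is asymptotically at least (log_q n) / theta, this
gives at most (theta/s + o(1)) H members.

Finally S + theta/s < 1 in all cases, so some Q is k-free.
*)

Require Import Defs.
From HB Require Import structures.
From mathcomp Require Import all_boot all_order all_algebra.
From mathcomp Require Import boolp classical_sets reals exp.
From mathcomp Require Import zify ring lra.

Set Implicit Arguments.
Unset Strict Implicit.
Unset Printing Implicit Defensive.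

Import Order.TTheory GRing.Theory Num.Theory.

Local Open Scope ring_scope.

(** * Coefficients along an arithmetic progression of exponents *)

Section Multisection.
Variable R : comNzRingType.
Implicit Types A B : {poly R}.

(** The bound [size A] loses nothing when [s > 0]: the coefficients of [A] that it cuts off
    vanish. *)
Definition multisect (s j : nat) A : {poly R} :=
  \poly_(e < size A) A`_(s * e + j).

Lemma coef_multisect s j A e : (0 < s)%N ->
  (multisect s j A)`_e = A`_(s * e + j).
Proof.
move=> s0; rewrite coef_poly; case: ltnP => // le; rewrite nth_default //.
by apply: (leq_trans le); rewrite -[X in (X <= _)%N]addn0 leq_add // leq_pmull.
Qed.

Lemma multisectD s j A B : (0 < s)%N ->
  multisect s j (A + B) = multisect s j A + multisect s j B.
Proof. by move=> s0; apply/polyP => e; rewrite coefD !coef_multisect // coefD. Qed.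

(** Multiplication by ['X^s] keeps the residue class of an exponent and shifts its index by one, so
    multisection is linear over polynomials in ['X^s]. *)
Lemma multisect_compM s j A B : (j < s)%N ->
  multisect s j ((A \Po 'X^s) * B) = A * multisect s j B.
Proof.
move=> js; have s0 : (0 < s)%N by case: s js.
elim/poly_ind: A => [|A c IH] in B *.
  by rewrite comp_poly0 !mul0r; apply/polyP=> e; rewrite coef_multisect // !coef0.
rewrite comp_poly_MXaddC mulrDl multisectD // -mulrA IH mulrDl -mulrA.
congr (_ * _ + _); apply/polyP=> e; last first.
  by rewrite coef_multisect // !coefCM coef_multisect.
rewrite coef_multisect // coefXnM coefXM; case: e => [|e] /=.
  by rewrite muln0 add0n js.
rewrite mulnS -addnA ltnNge leq_addr /= coef_multisect //; congr _`_(_).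
by rewrite addKn.
Qed.

Lemma size_multisect s j A n : (0 < s)%N -> (size A <= n.+1)%N ->
  (s * (size (multisect s j A)).-1 <= n)%N.
Proof.
move=> s0 szA; have [->|nz] := eqVneq (multisect s j A) 0.
  by rewrite size_poly0 muln0.
have : lead_coef (multisect s j A) != 0 by rewrite lead_coef_eq0.
rewrite lead_coefE coef_multisect //.
set e := _.-1 => ne; have : (s * e + j < size A)%N.
  by rewrite ltnNge; apply: contra ne => ?; rewrite nth_default.
by lia.
Qed.

End Multisection.

(** * Derivatives, Frobenius twists and the operator D *)

Lemma dvdp_derivn (K : fieldType) (P T : {poly K}) (i m : nat) :
  P ^+ (m + i) %| T -> P ^+ i %| T^`(m).
Proof.
elim: m T => [|m IH] T //; rewrite addSn => PT.
rewrite derivSn; apply: IH; have [U ->] : exists U, T = U * P ^+ (m + i).+1.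
  by exists (T %/ P ^+ (m + i).+1); rewrite divpK.
rewrite derivM deriv_exp /=; apply: dvdp_add.
  by rewrite exprS; apply: dvdp_mull; apply: dvdp_mull.
by apply: dvdp_mull; rewrite -mulrnAl; apply: dvdp_mull.
Qed.

Section Frobenius.
Variables (K : fieldType) (p : nat) (hp : p \in [pchar K]).
Implicit Types P Q T : {poly K}.

Let phi : {rmorphism K -> K} := pFrobenius_aut hp.

Definition frob_poly (a : nat) (P : {poly K}) : {poly K} :=
  iter a (map_poly phi) P.

Lemma size_frob_poly a P : size (frob_poly a P) = size P.
Proof. by elim: a => //= a IH; rewrite size_map_poly. Qed.

Lemma coprimep_frob_poly a P Q :
  coprimep (frob_poly a P) (frob_poly a Q) = coprimep P Q.
Proof. by elim: a => //= a IH; rewrite coprimep_map. Qed.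

(** In characteristic [p] the [p]-th power is additive, hence acts separately on the coefficients
    and on the variable. *)
Lemma exp_pchar_poly (P : {poly K}) : P ^+ p = map_poly phi P \Po 'X^p.
Proof.
have hpp : [pchar {poly K}].-nat p.
  have pr := pcharf_prime hp.
  apply/andP; split; first exact: prime_gt0.
  by rewrite primes_prime //= andbT inE pr /= -polyC_natr (pcharf0 hp).
elim/poly_ind: P => [|P c IH].
  by rewrite rmorph0 comp_poly0 expr0n (gtn_eqF (prime_gt0 (pcharf_prime hp))).
rewrite exprDn_pchar // exprMn IH rmorphD rmorphM /= map_polyX map_polyC /=.
by rewrite comp_poly_MXaddC -rmorphXn.
Qed.

Lemma frob_polyE a P : P ^+ (p ^ a) = frob_poly a P \Po 'X^(p ^ a).
Proof.
elim: a => [|a IH]; first by rewrite expn0 expr1 comp_polyXr.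
rewrite expnSr exprM IH -[LHS]comp_Xn_poly comp_polyA comp_Xn_poly.
by rewrite exp_pchar_poly -comp_polyA comp_Xn_poly -exprM mulnC.
Qed.

(** The operator D of the overview. Among all residue classes mod [p ^ a], the class of -1 has the
    fewest exponents below [N], namely [N %/ p ^ a]. *)
Definition digit_deriv (a d : nat) (Q : {poly K}) : {poly K} :=
  (multisect (p ^ a) (p ^ a).-1 Q)^`(d.-1).

Let s0 a : (0 < p ^ a)%N.
Proof. by rewrite expn_gt0 prime_gt0 // (pcharf_prime hp). Qed.

(** The power [P ^+ (d * p ^ a)] is the [d]-th power of the twist, evaluated at ['X^(p ^ a)]. It
    comes out of the multisection as that [d]-th power, of which [d.-1] derivatives leave at least
    one factor. *)
Lemma dvdp_digit_deriv a d k (P Q : {poly K}) : (0 < d)%N ->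
  (d * p ^ a <= k)%N -> P ^+ k %| Q -> frob_poly a P %| digit_deriv a d Q.
Proof.
move=> d0 dk PQ; have := dvdp_trans (dvdp_exp2l P dk) PQ.
case/dvdpP => B ->.
rewrite mulnC exprM frob_polyE -[(_ \Po _) ^+ d]comp_Xn_poly comp_polyA comp_Xn_poly mulrC /digit_deriv.
rewrite multisect_compM ?prednK // -[X in X %| _]expr1.
by apply: dvdp_derivn; rewrite addn1 prednK // dvdp_mulr.
Qed.

Lemma coef_digit_deriv a d Q e : (digit_deriv a d Q)`_e =
  Q`_(p ^ a * (d.-1 + e) + (p ^ a).-1) *+ (d.-1 + e) ^_ d.-1.
Proof. by rewrite coef_derivn coef_multisect. Qed.

Lemma digit_derivD a d Q T :
  digit_deriv a d (Q + T) = digit_deriv a d Q + digit_deriv a d T.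
Proof. by rewrite /digit_deriv multisectD // derivnD. Qed.

Lemma size_digit_deriv a d Q n : (size Q <= n.+1)%N ->
  (p ^ a * (size (digit_deriv a d Q)).-1 <= n)%N.
Proof.
move=> sz; apply: leq_trans (size_multisect (p ^ a).-1 (s0 a) sz).
rewrite leq_mul2l; apply/orP; right.
suff : (size (digit_deriv a d Q) <= size (multisect (p ^ a) (p ^ a).-1 Q))%N by lia.
apply/leq_sizeP => e le; rewrite coef_derivn nth_default ?mul0rn //.
exact: leq_trans le (leq_addl _ _).
Qed.

(** Among the factors [e - i] with [i < m], the one with [i = e %% p] is a multiple of [p]. *)
Lemma dvdn_ffact_modn e m : (e %% p < m)%N -> (p %| e ^_ m)%N.
Proof.
move=> lt; rewrite ffact_prod.
rewrite (bigD1 (Ordinal lt)) //= dvdn_mulr //.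
by rewrite {1}(divn_eq e p) addnK dvdn_mull.
Qed.

(** Since [i < m <= e %% p], no factor [e - i] comes down to a multiple of [p]. *)
Lemma ffact_modn_neq0 e m : (m <= e %% p)%N -> (e ^_ m)%:R != 0 :> K.
Proof.
move=> le; have pr := pcharf_prime hp; rewrite -(dvdn_pcharf hp).
rewrite ffact_prod; apply: (big_ind (fun x => ~~ (p %| x)%N)) => //; first by rewrite gtnNdvd // prime_gt1.
  by move=> x y; rewrite Euclid_dvdM // negb_or => -> ->.
move=> i _; have := ltn_ord i; have := ltn_pmod e (prime_gt0 pr) => lp im.
rewrite {1}(divn_eq e p) -addnBA; last by lia.
by rewrite dvdn_addr ?dvdn_mull // gtnNdvd; lia.
Qed.

End Frobenius.

(** * Irreducible factors and pairwise coprime divisors *)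

Lemma irredp_monic_dvd (K : fieldType) (P : {poly K}) : (1 < size P)%N ->
  exists D, [/\ irreducible_poly D, D \is monic & D %| P].
Proof.
have [n] := ubnP (size P); elim: n P => // n IH P szn sz1.
have P0 : P != 0 by rewrite -size_poly_gt0 ltnW.
have [irr|] := pselect (irreducible_poly P).
  have c0 : (lead_coef P)^-1 != 0 by rewrite invr_eq0 lead_coef_eq0.
  exists ((lead_coef P)^-1 *: P); split; last by rewrite dvdpZl.
    split; first by rewrite size_scale.
    by move=> Q Q1; rewrite dvdpZr // => /(apply_irredp irr Q1) /eqp_trans -> //; rewrite eqp_sym eqp_scale.
  by rewrite monicE lead_coefZ mulVf // lead_coef_eq0.
move=> nirr; have [Q [Q1 QP nQP]] : exists Q : {poly K}, [/\ size Q != 1%N, Q %| P & ~~ (Q %= P)].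
  apply: contrapT => noQ; apply: nirr; split=> // Q Q1 QP.
  by apply: contrapT => /negP nQ; apply: noQ; exists Q.
have Q0 : Q != 0 by apply: contraNneq P0 => Q0; move: QP; rewrite Q0 dvd0p.
have ltQ : (size Q < size P)%N.
  by rewrite ltn_neqAle dvdp_leq // andbT; apply: contra nQP; rewrite dvdp_size_eqp.
have /IH : (size Q < n)%N by exact: leq_trans ltQ _.
have Qgt : (1 < size Q)%N by have := size_poly_gt0 Q; rewrite Q0; lia.
case=> // D [iD mD DQ]; exists D; split=> //; exact: dvdp_trans DQ QP.
Qed.

Lemma irredp_monic_coprime (K : fieldType) (P Q : {poly K}) :
  irreducible_poly P -> irreducible_poly Q -> P \is monic -> Q \is monic ->
  P != Q -> coprimep P Q.
Proof.
move=> iP iQ mP mQ nPQ; rewrite irreducible_poly_coprime //.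
apply: contra nPQ => PQ; rewrite -eqp_monic //; apply: (apply_irredp iQ) => //.
by rewrite gtn_eqF // (fst iP).
Qed.

Lemma prod_dvdp_coprime (K : fieldType) (I : eqType) (r : seq I)
    (f : I -> {poly K}) (W : {poly K}) : uniq r ->
  {in r, forall i, f i %| W} ->
  {in r &, forall i j, i != j -> coprimep (f i) (f j)} ->
  \prod_(i <- r) f i %| W.
Proof.
elim: r => [|x r IH] /=; first by rewrite big_nil dvd1p.
case/andP => xr ur fW cop; rewrite big_cons Gauss_dvdp.
  rewrite fW ?mem_head // IH // => [i ir|i j ir jr].
    by rewrite fW // inE ir orbT.
  by apply: cop; rewrite inE ?ir ?jr orbT.
rewrite big_seq; apply: (big_ind (fun q => coprimep (f x) q)).
- exact: coprimep1.
- by move=> y z; rewrite coprimepMr => -> ->.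
move=> i ir; apply: cop; rewrite ?mem_head ?inE ?ir ?orbT //.
by apply: contraNneq xr => ->.
Qed.

(** The product of pairwise coprime divisors still divides [W], so their degrees add up to at most
    that of [W]. *)
Lemma card_coprime_divisors (K : fieldType) (T : finType) (A : {set T})
    (f : T -> {poly K}) (W : {poly K}) (m : nat) : W != 0 ->
  {in A, forall v, f v %| W} ->
  {in A &, forall u v, u != v -> coprimep (f u) (f v)} ->
  {in A, forall v, (m < size (f v))%N} ->
  (m * #|A| <= (size W).-1)%N.
Proof.
move=> W0 fW cop szf.
have dW : \prod_(v <- enum A) f v %| W.
  apply: prod_dvdp_coprime; first exact: enum_uniq.
    by move=> v; rewrite mem_enum; exact: fW.
  by move=> u v; rewrite !mem_enum; exact: cop.
have := dvdp_leq W0 dW; rewrite size_prod_seq; last first.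
  move=> v; rewrite mem_enum => /szf; rewrite -size_poly_gt0; exact: leq_ltn_trans.
have : (#|A| * m.+1 <= \sum_(v <- enum A) size (f v))%N.
  rewrite big_enum -sum_nat_const; exact: leq_sum.
rewrite -cardE => h1 h2; have aux (c x w : nat) :
  (c * m.+1 <= x -> x.+1 - c <= w -> m * c <= w.-1)%N by nia.
exact: aux h1 h2.
Qed.

Lemma card_bigcup_leq (I : Type) (r : seq I) (T : finType) (P : pred I)
    (A : I -> {set T}) :
  (#|\bigcup_(i <- r | P i) A i| <= \sum_(i <- r | P i) #|A i|)%N.
Proof.
elim/big_rec2: _ => [|i x y _ le]; first by rewrite cards0.
by rewrite (leq_trans (leq_card_setU _ _)) // leq_add2l.
Qed.

(** * Number of coefficients on which D depends *)

Definition digit_count (N p a d : nat) : nat :=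
  #|[pred e : 'I_(N %/ p ^ a) | (d.-1 <= e %% p)%N]|.

(** In each full period of length [p] exactly [p - d.-1] residues count, and a final partial period
    begins with those that do not, so the density bound holds without a rounding term. *)
Lemma digit_countP (N p a d : nat) : (0 < p)%N ->
  (p ^ a.+1 * digit_count N p a d <= (p - d.-1) * N)%N.
Proof.
move=> p_gt0; set s := (p ^ a)%N; set J := digit_count N p a d.
have key M : (\sum_(e < M) (d.-1 <= e %% p) =
    (M %/ p) * (p - d.-1) + (M %% p - d.-1))%N.
  elim: M => [|M IH]; first by rewrite big_ord0 div0n mod0n.
  rewrite big_ord_recr /= IH; have lt := ltn_pmod M p_gt0.
  have -> : M.+1 = (M %/ p * p + (M %% p).+1)%N by rewrite addnS -divn_eq.
  rewrite divnMDl // modnMDl.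
  have [E|nE] := eqVneq (M %% p).+1 p.
    by rewrite E divnn modnn p_gt0; nia.
  have lt' : ((M %% p).+1 < p)%N by rewrite ltn_neqAle nE.
  by rewrite (divn_small lt') (modn_small lt'); nia.
have : (p * J <= (p - d.-1) * (N %/ s))%N.
  rewrite /J /digit_count -sum1_card big_mkcond /=.
  rewrite (eq_bigr (fun e : 'I_(N %/ s) => (d.-1 <= e %% p) : nat)); last first.
    by move=> e _; rewrite inE; case: leqP.
  rewrite key {3}(divn_eq (N %/ s) p); have := ltn_pmod (N %/ s) p_gt0.
  by move: (_ %% _)%N (_ %/ p)%N => r t lt; nia.
move=> H.
rewrite expnSr -mulnA; apply: (@leq_trans (s * ((p - d.-1) * (N %/ s)))%N).
  by rewrite leq_mul2l H orbT.
by rewrite mulnCA leq_mul2l mulnC leq_divM orbT.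
Qed.

(** * Counting the members of an interval with a [k]-th power factor *)

Section Count.
Variables (K : finFieldType) (N : nat) (F : {poly K}).

Lemma size_rVpoly (v : 'rV[K]_N) : (size (rVpoly v) <= N)%N.
Proof. exact: size_poly. Qed.

(** Two such members differ by a multiple of [D] of size at most [N], and the quotient has at most
    [N - (size D).-1] coefficients. Truncated subtraction covers large [D], which divide at most one
    member. *)
Lemma card_dvdp_interval (D : {poly K}) : D != 0 ->
  (#|[set v : 'rV[K]_N | (D %| F + rVpoly v)%R]| <= #|K| ^ (N - (size D).-1))%N.
Proof.
move=> D0; set A := [set v | _].
have [->|[v0 Av0]] := set_0Vmem A; first by rewrite cards0.
pose f (v : 'rV[K]_N) : 'rV[K]_(N - (size D).-1) := poly_rV ((rVpoly v - rVpoly v0) %/ D).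
have fI : {in A &, injective f}.
  have H v : v \in A -> rVpoly v - rVpoly v0 = rVpoly (f v) * D.
    move: Av0; rewrite !inE => Dv0 Dv; rewrite poly_rV_K.
      rewrite divpK //; have := dvdp_sub Dv Dv0.
      by rewrite opprD addrACA subrr add0r.
    rewrite size_divp // leq_sub2r //.
    by rewrite (leq_trans (size_polyD _ _)) // size_polyN geq_max !size_rVpoly.
  move=> u v /H Hu /H Hv fuv; apply: (can_inj rVpolyK).
  by apply: (addIr (- rVpoly v0)); rewrite Hu Hv fuv.
rewrite -(card_in_imset fI); apply: leq_trans (max_card _) _.
by rewrite card_mx mul1n.
Qed.

Lemma monic_rVpoly m (P : {poly K}) : P \is monic -> size P = m.+1 ->
  exists w : 'rV[K]_m, P = 'X^m + rVpoly w.
Proof.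
move=> mP sz; exists (poly_rV (P - 'X^m)); rewrite poly_rV_K.
  by rewrite addrC subrK.
apply/leq_sizeP => i; rewrite leq_eqVlt coefB coefXn => /orP[/eqP <-|lt].
  by rewrite eqxx; move/monicP: mP; rewrite lead_coefE sz /= => ->; rewrite subrr.
by rewrite nth_default ?sz // gtn_eqF // subrr.
Qed.

Lemma size_XnrVpoly m (w : 'rV[K]_m) : size ('X^m + rVpoly w) = m.+1.
Proof. by rewrite size_polyDl size_polyXn // ltnS size_poly. Qed.

Definition irr_count m : nat :=
  #|[set w : 'rV[K]_m | irreducibleb ('X^m + rVpoly w)]|.

(** Union bound over the degree [m] of [P], then over the monic irreducibles of that degree. *)
Lemma card_small_factor k m0 :
  (#|[set v : 'rV[K]_N | `[< exists P : {poly K}, [/\ irreducible_poly P,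
      P \is monic, (size P <= m0.+1)%N & (P ^+ k %| F + rVpoly v)%R] >]]|
    <= \sum_(1 <= m < m0.+1) irr_count m * #|K| ^ (N - k * m))%N.
Proof.
pose B m (w : 'rV[K]_m) :=
  [set v : 'rV[K]_N | ('X^m + rVpoly w) ^+ k %| F + rVpoly v].
pose U m := \bigcup_(w in [set w : 'rV[K]_m | irreducibleb ('X^m + rVpoly w)]) @B m w.
apply: (@leq_trans #|\bigcup_(m <- index_iota 1 m0.+1) U m|).
  apply/subset_leq_card/fintype.subsetP => v; rewrite inE => /asboolP[P [iP mP sz dv]].
  have gt1 : (1 < size P)%N := fst iP; have sP : size P = (size P).-1.+1 by lia.
  have [w Pw] := monic_rVpoly mP sP.
  have szm : (0 < (size P).-1 < m0.+1)%N by rewrite -ltnS -sP gt1.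
  rewrite (big_rem (size P).-1) /=; last by rewrite mem_index_iota.
  rewrite inE; apply/orP; left; apply/bigcupP; exists w.
    by rewrite inE -Pw; apply/irreducibleP.
  by rewrite inE -Pw.
apply: leq_trans (card_bigcup_leq _ _ _) _; apply: leq_sum => m _.
apply: leq_trans (card_bigcup_leq _ _ _) _.
rewrite -sum_nat_const; apply: leq_sum => w _.
have nz : ('X^m + rVpoly w) != 0 by rewrite -size_poly_gt0 size_XnrVpoly.
apply: leq_trans (card_dvdp_interval _) _; first by rewrite expf_neq0.
by rewrite size_exp size_XnrVpoly mulnC.
Qed.

Section Char.
Variables (p : nat) (hp : p \in [pchar K]) (a d : nat).
Hypotheses (d_gt0 : (0 < d)%N) (d_lt : (d < p)%N).
Local Notation s := (p ^ a)%N.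
Local Notation D := (digit_deriv p a d).

Let p_gt0 : (0 < p)%N. Proof. exact/prime_gt0/(pcharf_prime hp). Qed.
Let s_gt0 : (0 < s)%N. Proof. by rewrite expn_gt0 p_gt0. Qed.

(** The vanishing of D prescribes [C] of the [N] coordinates of [v]. *)
Lemma card_digit_deriv_eq0 C : (s * p * C <= N)%N ->
  (#|[set v : 'rV[K]_N | D (F + rVpoly v)%R == 0%R]| <= #|K| ^ (N - C))%N.
Proof.
move=> CN; set A := [set v | _].
(* The coefficient of D at exponent [j * p] is that of its argument at [i j] times a falling
   factorial, nonzero in [K] because [d.-1 + j * p] is congruent to [d.-1] mod [p]. *)
pose i (j : 'I_C) := (s * (d.-1 + j * p) + s.-1)%N.
have iN j : (i j < N)%N.
  apply: leq_trans CN; rewrite -mulnA /i.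
  have h : ((d.-1 + j * p).+1 <= p * C)%N.
    have jC : (p * j.+1 <= p * C)%N by rewrite leq_mul2l ltn_ord orbT.
    by apply: leq_trans jC; rewrite mulnS mulnC; lia.
  apply: (@leq_trans (s * (d.-1 + j * p).+1)); last by rewrite leq_mul2l h orbT.
  by rewrite mulnS addnC -ltn_subRL; lia.
pose J : {set 'I_N} := [set Ordinal (iN j) | j : 'I_C].
have cJ : #|J| = C.
  rewrite card_imset ?card_ord // => j1 j2 [] /eqP.
  rewrite eqn_add2r eqn_pmul2l // eqn_add2l eqn_pmul2r // => /eqP ?.
  exact: val_inj.
pose f (v : 'rV[K]_N) : {ffun {x : 'I_N | x \in ~: J} -> K} := [ffun x => v 0 (val x)].
have AJ (v : 'rV[K]_N) j : v \in A -> v 0 (Ordinal (iN j)) = - F`_(i j).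
  rewrite inE => /eqP /polyP /(_ (j * p)%N).
  rewrite coef_digit_deriv // coef0 -mulr_natr => /eqP.
  rewrite mulf_eq0 (negPf (ffact_modn_neq0 hp _)) ?orbF; last first.
    by rewrite addnC modnMDl modn_small //; lia.
  rewrite coefD coef_rVpoly (insubT (fun x => x < N)%N (iN j)) addrC addr_eq0 => /eqP <-.
  by congr (v _ _); apply: val_inj.
have fI : {in A &, injective f}.
  move=> u v Au Av fuv; apply/rowP => x.
  have [/imsetP[j _ ->]|xJ] := boolP (x \in J); first by rewrite !AJ.
  have xJ' : x \in ~: J by rewrite inE.
  by move/ffunP/(_ (exist _ x xJ')): fuv; rewrite !ffunE.
rewrite -(card_in_imset fI); apply: leq_trans (max_card _) _.
rewrite card_ffun card_sig; apply: leq_pexp2l; first by apply/card_gt0P; exists 0.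
have <- : #|~: J| = (N - C)%N by have := cardsC J; rewrite card_ord cJ; lia.
by apply/eq_leq/eq_card => x; rewrite !inE.
Qed.

(** The members are split into fibres on which D is constant. Within a fibre the twisted factors are
    pairwise coprime divisors of one nonzero polynomial of degree at most [n / s]. *)
Lemma card_large_factor k n m : (d * s <= k)%N -> (N <= k * m)%N ->
  (size F <= n.+1)%N -> (N <= n.+1)%N ->
  (s * (m * #|[set v : 'rV[K]_N | `[< exists P : {poly K},
      [/\ irreducible_poly P, P \is monic, (m < size P)%N,
        (P ^+ k %| F + rVpoly v)%R & D (F + rVpoly v)%R != 0%R] >]]|)
    <= n * #|K| ^ digit_count N p a d)%N.
Proof.
move=> dk Nk szF Nn; set L := [set v | _].
pose X := {e : 'I_(N %/ s) | (d.-1 <= e %% p)%N}.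
(* These coordinates determine D: at any other index the falling factorial vanishes in [K] or the
   exponent is at least [N]. *)
pose rho (v : 'rV[K]_N) : {ffun X -> K} :=
  [ffun e => (rVpoly v)`_(s * val (val e) + s.-1)].
have fiber y : (s * (m * #|[set v in L | rho v == y]|) <= n)%N.
  set Y := [set v in L | _].
  have [->|[v0 Yv0]] := set_0Vmem Y; first by rewrite cards0 !muln0.
  pose W := D (F + rVpoly v0).
  have WE v : v \in Y -> D (F + rVpoly v) = W.
    move: Yv0; rewrite !inE => /andP[_ /eqP r0] /andP[_ /eqP rv].
    rewrite /W !digit_derivD //; congr (_ + _); apply/polyP => e.
    rewrite !coef_digit_deriv //; set e' := (_ + e)%N.
    have [lt|le] := ltnP (e' %% p) d.-1.
      have z : (e' ^_ d.-1)%:R = 0 :> K.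
        by apply/eqP; rewrite -(dvdn_pcharf hp) dvdn_ffact_modn.
      by rewrite -[LHS]mulr_natr -[RHS]mulr_natr z !mulr0.
    congr (_ *+ _); have [eM|Me] := ltnP e' (N %/ s).
      have := congr1 (fun g : {ffun X -> K} => g (exist _ (Ordinal eM) le)) (etrans rv (esym r0)).
      by rewrite !ffunE.
    have NM : (N <= s * e' + s.-1)%N.
      rewrite {1}(divn_eq N s); have := ltn_pmod N s_gt0.
      by move: Me; rewrite mulnC -(leq_pmul2l s_gt0); lia.
    by rewrite !nth_default // (leq_trans (size_rVpoly _)).
  have /choice[f Pf] (v : 'rV[K]_N) : exists P : {poly K}, v \in Y ->
      [/\ irreducible_poly P, P \is monic, (m < size P)%N,
        P ^+ k %| F + rVpoly v & D (F + rVpoly v) != 0].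
    have [|nY] := boolP (v \in Y); last by exists 0.
    by rewrite !inE => /andP[/asboolP[P HP] _]; exists P.
  have W0 : W != 0 by have [] := Pf _ Yv0.
  (* A shared factor would have its [k]-th power, of degree at least [N], divide a nonzero
     difference of degree below [N]. *)
  have fI : {in Y &, injective f}.
    move=> u v /Pf [iu mu su du _] /Pf [_ _ _ dv _] fuv.
    apply: (can_inj rVpolyK); apply/eqP; rewrite -subr_eq0; apply/negPn/negP => nz.
    have : f u ^+ k %| rVpoly u - rVpoly v.
      rewrite -fuv in dv; have := dvdp_sub du dv.
      by rewrite opprD addrACA subrr add0r.
    move/(dvdp_leq nz) => le.
    have lt : ((size (f u)).-1 * k < size (rVpoly u - rVpoly v)%R)%N.
      apply: leq_trans le; rewrite -size_exp prednK // size_poly_gt0.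
      by rewrite expf_neq0 // irredp_neq0.
    have leN : (size (rVpoly u - rVpoly v)%R <= N)%N.
      by rewrite (leq_trans (size_polyD _ _)) // size_polyN geq_max !size_rVpoly.
    have /leq_trans/(_ leN) := lt; rewrite ltnNge => /negP; apply.
    rewrite (leq_trans Nk) // mulnC leq_mul2r; apply/orP; right.
    by rewrite -ltnS prednK // (leq_trans _ su).
  have : (m * #|Y| <= (size W).-1)%N.
    apply: (@card_coprime_divisors _ _ Y (fun v => frob_poly hp a (f v))) => //.
    - move=> v Yv; have [_ _ _ dv _] := Pf v Yv.
      by rewrite -(WE v Yv); apply: dvdp_digit_deriv dv.
    - move=> u v Yu Yv uv; rewrite coprimep_frob_poly.
      have [? ? _ _ _] := Pf u Yu; have [? ? _ _ _] := Pf v Yv.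
      apply: irredp_monic_coprime => //; apply: contra uv => /eqP fuv.
      by apply/eqP; exact: fI.
    - by move=> v Yv; rewrite size_frob_poly; have [] := Pf v Yv.
  have szQ : (size (F + rVpoly v0)%R <= n.+1)%N.
    rewrite (leq_trans (size_polyD _ _)) // geq_max szF /=.
    exact: leq_trans (size_rVpoly v0) Nn.
  move=> h; apply: leq_trans (size_digit_deriv hp a d szQ).
  by rewrite leq_mul2l h orbT.
have -> : #|L| = (\sum_y #|[set v in L | rho v == y]|)%N.
  rewrite -sum1_card (partition_big rho predT) //=.
  by apply: eq_bigr => y _; rewrite -sum1_card; apply: eq_bigl => v; rewrite inE.
rewrite big_distrr big_distrr /=.
apply: (@leq_trans (\sum_(y : {ffun X -> K}) n)%N).
  by apply: leq_sum => y _; exact: fiber.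
by rewrite sum_nat_const card_ffun card_sig mulnC.
Qed.

End Char.
End Count.

(** * Counts of irreducibles and the covering inequality *)

Lemma leq_pchar_card (K : finFieldType) (p : nat) : p \in [pchar K] ->
  (p <= #|K|)%N.
Proof.
move=> hp; rewrite -[X in (X <= _)%N]card_ord.
apply: (@leq_card _ _ (fun i : 'I_p => i%:R : K)) => i j.
wlog ij : i j / (i <= j)%N.
  move=> H; have [/H//|/ltnW/H ji] := leqP i j.
  by move/esym/ji/esym.
move/esym/eqP; rewrite -subr_eq0 -natrB // -(dvdn_pcharf hp) => pd.
apply/val_inj/eqP; rewrite /= eqn_leq ij /= -subn_eq0.
by apply: contraTT pd; rewrite -lt0n => gt; rewrite gtnNdvd // (leq_ltn_trans (leq_subr _ _)).
Qed.

Lemma irr_count_leq (K : finFieldType) m : (irr_count K m <= #|K| ^ m)%N.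
Proof. by apply: leq_trans (max_card _) _; rewrite card_mx mul1n. Qed.

(* An irreducible polynomial of degree at least 2 takes the value 1 at both
   points of the field, which fixes its two lowest coefficients. *)
Lemma irr_count_card2 (K : finFieldType) m : #|K| = 2%N -> (2 <= m)%N ->
  (irr_count K m <= 2 ^ (m - 2))%N.
Proof.
move=> K2 m2; rewrite /irr_count; set A := [set w | _].
have nz1 (x : K) : x != 0 -> x = 1.
  move=> x0; apply/eqP; apply: contraT => x1.
  have /card_uniqP U : uniq [:: 0; 1; x].
    by rewrite /= !inE !negb_or eq_sym oner_neq0 eq_sym x0 eq_sym x1.
  by have := max_card [in [:: 0; 1; x]]; rewrite U K2.
have ev1 (w : 'rV[K]_m) c : w \in A -> ('X^m + rVpoly w).[c] = 1.
  rewrite inE => /irreducibleP iw; apply: nz1; apply/negP => /eqP wc.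
  have : 'X - c%:P %| 'X^m + rVpoly w by rewrite dvdp_XsubCl; apply/rootP.
  move=> /(apply_irredp iw); rewrite size_XsubC => /(_ isT) /eqp_size.
  by rewrite size_XsubC size_XnrVpoly; lia.
pose f (w : 'rV[K]_m) : 'rV[K]_(m - 2) := \row_i (rVpoly w)`_(i + 2).
have fI : {in A &, injective f}.
  move=> u v Au Av fuv; apply: (can_inj rVpolyK); apply/eqP; rewrite -subr_eq0.
  (* The difference has size at most 2 and vanishes at both 0 and 1. *)
  apply/eqP; apply: (@roots_geq_poly_eq0 _ _ [:: 0; 1]).
  - have E c : (rVpoly u - rVpoly v).[c] = 0.
      have := congr1 (fun x => x - ('X^m + rVpoly v).[c]) (ev1 u c Au).
      by rewrite {2}(ev1 v c Av) subrr -hornerN -hornerD opprD addrACA subrr add0r.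
    by rewrite /= !rootE !E eqxx.
  - by rewrite /= inE eq_sym oner_neq0.
  - apply/leq_sizeP => i /= i2; rewrite coefB.
    have [im|mi] := ltnP i m; last first.
      by rewrite !nth_default ?subrr // (leq_trans (size_rVpoly _)).
    have im2 : (i - 2 < m - 2)%N by lia.
    by move/rowP/(_ (Ordinal im2)): fuv; rewrite !mxE /= subnK // => ->; rewrite subrr.
rewrite -(card_in_imset fI); apply: leq_trans (max_card _) _.
by rewrite card_mx mul1n K2.
Qed.

(** Three classes cover an interval without [k]-free members: a small irreducible factor, D equal to
    zero, or a large factor with D nonzero. Here [l] is the size of the third class. *)
Lemma not_kfree_count (K : finFieldType) (p : nat) (hp : p \in [pchar K])
    (a d k N n C : nat) (F : {poly K}) :
  (0 < d)%N -> (d < p)%N -> (d * p ^ a <= k)%N ->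
  (size F <= n.+1)%N -> (N <= n.+1)%N -> (p ^ a * p * C <= N)%N ->
  (N <= k * (N - C))%N ->
  (forall v : 'rV[K]_N, ~ kfree k (F + rVpoly v)) ->
  exists2 l : nat,
    (p ^ a * ((N - C) * l) <= n * #|K| ^ digit_count N p a d)%N &
    (#|K| ^ N <= \sum_(1 <= m < (N - C).+1) irr_count K m * #|K| ^ (N - k * m)
       + #|K| ^ (N - C) + l)%N.
Proof.
move=> d0 dp dk szF Nn CN NC bad.
have large := card_large_factor hp d0 dp dk NC szF Nn.
have small := card_small_factor N F k (N - C).
have ker := card_digit_deriv_eq0 F hp d0 dp CN.
set L := [set _ | _] in large.
set S := [set _ | _] in small.
set Z := [set _ | _] in ker.
exists #|L| => //; apply: leq_trans (leq_add (leq_add small ker) (leqnn #|L|)).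
suff : (#|K| ^ N <= #|S :|: Z :|: L|)%N.
  move/leq_trans; apply; apply: leq_trans (leq_of_leqif (leq_card_setU _ _)) _.
  by rewrite leq_add2r leq_card_setU.
have -> : (#|K| ^ N)%N = #|[set: 'rV[K]_N]| by rewrite cardsT card_mx mul1n.
apply/subset_leq_card/fintype.subsetP => v _.
have : exists P : {poly K}, (1 < size P)%N /\ P ^+ k %| F + rVpoly v.
  apply: contrapT => noP; apply: (bad v) => P szP; apply/negP => PF.
  by apply: noP; exists P.
case=> P [szP PF]; have [Q [iQ mQ QP]] := irredp_monic_dvd szP.
have QF : Q ^+ k %| F + rVpoly v by apply: dvdp_trans PF; exact: dvdp_exp2r.
rewrite !finset.in_setU; have [szQ|szQ] := leqP (size Q) (N - C).+1.
  by have -> : v \in S by rewrite inE; apply/asboolP; exists Q.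
have [vZ|vZ] := boolP (v \in Z); first by rewrite orbT.
have -> : v \in L; last by rewrite orbT.
rewrite inE; apply/asboolP; exists Q; split=> //; first exact: ltnW.
by move: vZ; rewrite inE.
Qed.

(** * Numerical constants and real inequalities *)

Section Constants.
Variable R : realType.

(* For q = k = 2 the generic value is 1, too large to conclude; 5/8 comes from
   [irr_count_card2]. *)
Definition sieve_const (q k : nat) : R :=
  if (q == 2) && (k == 2) then 5 / 8 else (q%:R ^+ k.-1 - 1)^-1.

Lemma sum_geom_inv_le (y : R) M : 1 < y ->
  \sum_(1 <= m < M.+1) (y ^+ m)^-1 <= (y - 1)^-1.
Proof.
move=> y1; have y0 : 0 < y by lra.
have H : \sum_(1 <= m < M.+1) (y ^+ m)^-1 = (y - 1)^-1 - (y ^+ M)^-1 * (y - 1)^-1.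
  elim: M => [|M IH]; first by rewrite big_nil expr0 invr1 mul1r subrr.
  rewrite big_nat_recr //= IH exprS invfM; field.
  by rewrite expf_neq0 ?gt_eqF // subr_gt0.
rewrite H gerBl mulr_ge0 // invr_ge0; first by rewrite exprn_ge0 // ltW.
by rewrite subr_ge0 ltW.
Qed.

(** Bounding [irr_count] by [q ^ m] leaves a geometric series of ratio [q ^ -(k-1)]. For [q = k = 2]
    the term [m = 1] is at most 1/2 and the later ones at most [2 ^ (m-2) / 4 ^ m], with total
    1/8. *)
Lemma sum_irr_count_le (K : finFieldType) (k M : nat) : (2 <= k)%N ->
  (2 <= #|K|)%N ->
  \sum_(1 <= m < M.+1) (irr_count K m)%:R / #|K|%:R ^+ (k * m)
    <= sieve_const #|K| k :> R.
Proof.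
move=> k2 q2; rewrite /sieve_const; set q : R := #|K|%:R.
have q2R : 2 <= q by rewrite /q ler_nat.
have q0 : 0 < q by lra.
case: ifP => [/andP[/eqP K2 /eqP ->]|_]; last first.
  have y1 : 1 < q ^+ k.-1.
    by rewrite exprn_egt1; [lia | lra].
  apply: le_trans (sum_geom_inv_le M y1); apply: ler_sum_nat => m _.
  rewrite ler_pdivrMr ?exprn_gt0 // -exprM.
  have -> : (k * m = k.-1 * m + m)%N by case: k k2 {y1} => // k _; rewrite mulSn addnC.
  rewrite exprD mulKf ?gt_eqF ?exprn_gt0 //.
  by rewrite -natrX ler_nat irr_count_leq.
have -> : q = 2 by rewrite /q K2.
case: M => [|M]; first by rewrite big_nil; lra.
(* The subtracted term is the exact tail of the majorant, which lets the induction close. *)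
suff : \sum_(1 <= m < M.+2) (irr_count K m)%:R / 2 ^+ (2 * m)
    <= 5 / 8 - (2 ^+ M.+1)^-1 / 4 :> R.
  move/le_trans; apply; rewrite gerBl divr_ge0 // invr_ge0 exprn_ge0 //.
elim: M => [|M IH].
  rewrite big_nat1; have := irr_count_leq K 1; rewrite K2 -(ler_nat R) natrX => h.
  by rewrite muln1 expr2 expr1; lra.
rewrite big_nat_recr //=; have := irr_count_card2 (m := M.+2) K2 isT.
rewrite !subSS subn0 -(ler_nat R) natrX => h.
have e0 : 0 < 2 ^+ M :> R by rewrite exprn_gt0.
have E : (irr_count K M.+2)%:R / 2 ^+ (2 * M.+2) <= 2 ^+ M / 2 ^+ (2 * M.+2) :> R.
  by rewrite ler_pM2r // invr_gt0 exprn_gt0.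
apply: le_trans (lerD IH E) _.
have -> : 2 ^+ M / 2 ^+ (2 * M.+2) = (2 ^+ M)^-1 / 16 :> R.
  have -> : (2 * M.+2 = M + M + 4)%N by lia.
  by rewrite !exprD; field; rewrite gt_eqF.
rewrite !exprS; set x : R := 2 ^+ M.
have -> : (2 * x)^-1 = x^-1 / 2 by field; rewrite gt_eqF.
have -> : (2 * (2 * x))^-1 = x^-1 / 4 by field; rewrite gt_eqF.
by lra.
Qed.

(** When [k * m > N] the truncated exponent makes the term at most [q ^ m]; such terms add up to at
    most [2 * q ^ M]. *)
Lemma sieve_sum_le (K : finFieldType) (k N M : nat) : (2 <= k)%N ->
  (2 <= #|K|)%N ->
  (\sum_(1 <= m < M.+1) irr_count K m * #|K| ^ (N - k * m))%:R
    <= sieve_const #|K| k * #|K|%:R ^+ N + 2 * #|K|%:R ^+ M :> R.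
Proof.
move=> k2 q2; set q : R := #|K|%:R.
have q2R : 2 <= q by rewrite /q ler_nat.
have q0 : 0 < q by lra.
have term m : (irr_count K m * #|K| ^ (N - k * m))%:R <=
    (irr_count K m)%:R / q ^+ (k * m) * q ^+ N + q ^+ m.
  have [le|lt] := leqP (k * m) N.
    rewrite natrM natrX -/q -mulrA -[X in X <= _]addr0.
    apply: lerD; last by rewrite exprn_ge0 // ltW.
    rewrite -{2}(subnKC le) exprD mulKf // gt_eqF // exprn_gt0 //.
  have -> : (N - k * m = 0)%N by lia.
  rewrite muln1 -[X in X <= _]add0r; apply: lerD.
    by rewrite mulr_ge0 ?divr_ge0 // exprn_ge0 // ltW.
  by rewrite -natrX ler_nat irr_count_leq.
have geo : \sum_(1 <= m < M.+1) q ^+ m <= 2 * q ^+ M.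
  elim: M => [|M IH]; first by rewrite big_nil expr0; lra.
  rewrite big_nat_recr //= exprS.
  have := exprn_gt0 M q0; move: IH; set x := q ^+ M; nra.
rewrite natr_sum; apply: le_trans (ler_sum_nat _) _.
  by move=> m _; exact: term.
rewrite big_split /= -big_distrl /=; apply: lerD geo.
by rewrite ler_wpM2r ?exprn_ge0 ?(ltW q0) // sum_irr_count_le.
Qed.

Lemma base_repr_bounds (p k a : nat) (d : nat -> nat) : base_repr p k a d ->
  [/\ (0 < d a)%N, (d a < p)%N, (d a * p ^ a <= k)%N & a = 0%N -> k = d a].
Proof.
case=> -> dlt da0; split; first by rewrite lt0n.
- exact: dlt.
- by rewrite big_nat_recr //= leq_addl.
- by move=> ->; rewrite big_nat1 expn0 muln1.
Qed.

(** As [p - d + 1 <= p <= p ^ a.+1], theta vanishes only for [a = 0] and [d = 1], that is, for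
    [k = 1]. *)
Lemma theta_gt0 (p k a : nat) (d : nat -> nat) : (2 <= k)%N ->
  base_repr p k a d -> 0 < theta R p (d a) a.
Proof.
move=> k2 /base_repr_bounds[d0 dp dk ak]; rewrite /theta.
have pR : 2 <= p%:R :> R by rewrite ler_nat; lia.
rewrite subr_gt0 ltr_pdivrMr ?mul1r; last by rewrite exprn_gt0 //; lra.
case: a ak d0 dp {dk} => [/(_ erefl) <- _ kp|a _ d0 dp].
  have : 2 <= k%:R :> R by rewrite ler_nat.
  by rewrite expr1; lra.
have : 1 <= (d a.+1)%:R :> R by rewrite ler1n.
have : 1 <= p%:R ^+ a :> R by rewrite exprn_ege1 //; lra.
by rewrite !exprS; nra.
Qed.

(** If [a = 0] then [k] is its own digit, [p >= 3] and theta is [(k - 1) / p]: [k = 2] gives at most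
    1/3 + 1/2, while for [k >= 3] the gap [1 - theta >= 2 / p] exceeds [1 / (p ^ 2 - 1)]. If [a > 0]
    the second summand is below 1/2 and the first at most 1/2, except for [q = k = 2], where the sum
    is 5/8 + 1/4. *)
Lemma sieve_const_theta_lt1 (q p k a : nat) (d : nat -> nat) : (2 <= k)%N ->
  (p <= q)%N -> base_repr p k a d ->
  sieve_const q k + theta R p (d a) a / p%:R ^+ a < 1.
Proof.
move=> k2 pq /base_repr_bounds[d0 dp dk ak].
have pR : 2 <= p%:R :> R by rewrite ler_nat; lia.
have pqR : p%:R <= q%:R :> R by rewrite ler_nat.
have dpR : (d a)%:R + 1 <= p%:R :> R by rewrite natr1 ler_nat.
case: a ak d0 dp dk dpR => [/(_ erefl) kd d0 dp _ dpR|a _ d0 dp dk dpR].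
  rewrite /theta expr0 expr1 divr1 -kd in dpR *; rewrite -kd in dp.
  have p3 : 3 <= p%:R :> R by rewrite ler_nat; lia.
  have pr0 : p%:R != 0 :> R by rewrite gt_eqF //; lra.
  rewrite /sieve_const ifF; last by lia.
  have [k2'|k3] := leqP k 2.
    have -> : k = 2%N by lia.
    have -> : 1 - (p%:R - 2%:R + 1) / p%:R = p%:R^-1 :> R by field.
    have h1 : p%:R^-1 <= 3^-1 :> R by rewrite lef_pV2 ?posrE //; lra.
    have h2 : (q%:R ^+ 1 - 1)^-1 <= 2^-1 :> R by rewrite lef_pV2 ?posrE ?expr1 //; lra.
    by move: h2; rewrite /=; lra.
  have qk : p%:R ^+ 2 <= q%:R ^+ k.-1 :> R.
    apply: (@le_trans _ _ (q%:R ^+ 2)); first by rewrite lerXn2r // nnegrE.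
    by rewrite ler_weXn2l //; [lra | lia].
  have h1 : (q%:R ^+ k.-1 - 1)^-1 <= (p%:R ^+ 2 - 1)^-1 :> R.
    by rewrite lef_pV2 ?posrE; nra.
  have h2 : (p%:R ^+ 2 - 1)^-1 < 2 / p%:R :> R.
    rewrite ltr_pdivlMr; last by lra.
    rewrite mulrC ltr_pdivrMr; nra.
  have h3 : (1 - (p%:R - k%:R + 1) / p%:R) + 2 / p%:R <= 1 :> R.
    rewrite -lerBrDr -subr_ge0 (_ : _ - _ = (p%:R - k%:R - 1) / p%:R); last by field.
    by apply: divr_ge0; lra.
  by lra.
have ta : theta R p (d a.+1) a.+1 < 1.
  rewrite /theta gtrBl divr_gt0 ?exprn_gt0; lra.
have pa : 1 <= p%:R ^+ a :> R by rewrite exprn_ege1 //; lra.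
rewrite /sieve_const; case: ifP => [/andP[/eqP q2 /eqP kk]|nqk].
  have p2 : p = 2%N by lia.
  have a0 : a = 0%N.
    move: dk; rewrite kk p2 expnS => h; apply/eqP; apply: contraT; rewrite -lt0n => a0.
    by have : (2 ^ 1 <= 2 ^ a)%N by [rewrite leq_exp2l]; nia.
  have d1 : d a.+1 = 1%N by lia.
  by rewrite /theta d1 p2 a0 !exprS expr0; lra.
have h1 : theta R p (d a.+1) a.+1 / p%:R ^+ a.+1 < 2^-1.
  rewrite ltr_pdivrMr ?exprn_gt0 //; last by lra.
  by rewrite exprS; nra.
have h2 : 3 <= q%:R ^+ k.-1 :> R.
  rewrite -natrX ler_nat; have q2 : (2 <= q)%N by lia.
  have [k2'|k3] := leqP k 2.
    by have -> : k = 2%N; rewrite /= ?expn1; lia.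
  have : (2 ^ 2 <= q ^ k.-1)%N.
    by apply: (@leq_trans (2 ^ k.-1)); [rewrite leq_exp2l | rewrite leq_exp2r]; lia.
  by apply: leq_trans.
have h3 : (q%:R ^+ k.-1 - 1)^-1 <= 2^-1 :> R by rewrite lef_pV2 ?posrE; lra.
by lra.
Qed.

(** Applying [ln y < y] at [y = t * L] with [t = B / (2 * A)] uses half of the slope [B]; the other
    half absorbs the constants. *)
Lemma ln_le_linear (A B D : R) : 0 < A -> 0 < B ->
  exists L0, forall L, L0 <= L -> A * ln L + D <= B * L.
Proof.
move=> A0 B0; pose t := B / (2 * A).
have t0 : 0 < t by rewrite divr_gt0 // mulr_gt0.
exists (Num.max 1 (2 * (D - A * ln t) / B)) => L; rewrite ge_max => /andP[L1 hL].
have L0 : 0 < L by lra.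
have h : ln L <= t * L - ln t.
  rewrite lerBrDr -lnM ?posrE // mulrC; apply/ltW/ln_sublinear; exact: mulr_gt0.
rewrite ler_pdivrMr // in hL.
have : A * ln L <= A * (t * L - ln t) by rewrite ler_pM2l.
have -> : A * (t * L - ln t) = B / 2 * L - A * ln t.
  by rewrite /t; field; rewrite gt_eqF.
lra.
Qed.

End Constants.

(** * Assembling the estimates *)

Lemma kfree1 (K : fieldType) (k : nat) : (0 < k)%N -> kfree k (1 : {poly K}).
Proof.
move=> k0 P szP; apply/negP => /(dvdp_trans (dvdp_exp k0 (dvdpp P))).
by rewrite dvdp1 => /eqP E; rewrite E in szP.
Qed.

(** The source of the exponent: [1 - theta] is the density [(p - d + 1) / p ^ a.+1] of the
    coefficients that D sees. *)
Lemma digit_count_le (R : realType) (N p a d : nat) : (0 < d)%N -> (d < p)%N ->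
  (digit_count N p a d)%:R <= (1 - theta R p d a) * N%:R.
Proof.
move=> d0 dp; have p0 : (0 < p)%N by lia.
have p0R : 0 < p%:R ^+ a.+1 :> R by rewrite exprn_gt0 // ltr0n.
have := digit_countP N a d p0; rewrite -(ler_nat R) !natrM natrX natrB; last by lia.
rewrite -subn1 natrB // /theta => h.
rewrite -(ler_pM2l p0R) (le_trans h) // le_eqVlt; apply/orP; left; apply/eqP.
by field; rewrite gt_eqF // ltr0n.
Qed.

Theorem theorem1p2 (R : realType) (k : nat) (hk : (2 <= k)%N)
    (K : finFieldType) (q : nat) (hq : #|K| = q)
    (p : nat) (hp : p \in [pchar K])
    (a : nat) (d : nat -> nat) (hd : base_repr p k a d) :
  exists n0 : nat, forall n : nat, (n0 <= n)%N ->
    forall F : {poly K}, F \is monic -> size F = n.+1 ->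
    forall h : int,
      (n%:R / logb q%:R n%:R) `^ (1 / theta R p (d a) a) < (q%:R : R) ^ (h + 1) ->
      exists Q : {poly K}, short_interval F h Q /\ kfree k Q.
Proof.
have arith (C x N : nat) : (2 * C + x * C < N)%N ->
    [/\ (x * C <= N)%N, (N <= 2 * (N - C))%N & (C < N)%N].
  by move: (x * C)%N => y; split; lia.
have [d0 dp dk _] := base_repr_bounds hd.
have pq : (p <= q)%N by rewrite -hq leq_pchar_card.
have q2 : (2 <= q)%N by lia.
have th0 := theta_gt0 R hk hd.
have eps0 := sieve_const_theta_lt1 R hk pq hd.
have dc N := digit_count_le R N a d0 dp.
set th := theta R p (d a) a in th0 eps0 dc *.
set s : R := p%:R ^+ a in eps0.
set S := sieve_const R q k in eps0.
have s1 : 1 <= s by rewrite exprn_ege1 // ler1n; lia.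
(* A third of the slack: one [del] pays for the [q ^ -C] terms, one for replacing [th] by
   [th + del], and the last keeps the inequality strict. *)
pose del : R := (1 - (S + th / s)) / 3.
have del0 : 0 < del by rewrite /del; lra.
have q2R : 2 <= q%:R :> R by rewrite ler_nat.
have q0 : 0 < q%:R :> R by lra.
have lq0 : 0 < ln q%:R :> R by rewrite ln_gt0 //; lra.
(* The 3 counts two copies of [q ^ (N - C)] from the sieve sum and one from the members with D equal
   to zero. *)
have [C HC] : exists C : nat, 3 / q%:R ^+ C <= del.
  have := archi_boundP (divr_ge0 (ler0n R 3) (ltW del0)).
  set C := Num.bound _ => HC; exists C.
  rewrite ler_pdivrMr ?exprn_gt0 // mulrC -ler_pdivrMr //.
  apply: le_trans (ltW HC) _; rewrite -natrX ler_nat; apply: ltnW.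
  exact: ltn_expl.
pose N0 := (2 * C + p ^ a * p * C)%N.
have A1 : 0 < (ln q%:R)^-1 :> R by rewrite invr_gt0.
have B2 : 0 < del / th by rewrite divr_gt0.
have A2 : 0 < (1 + del / th) / ln q%:R by rewrite divr_gt0 //; lra.
(* With [L] standing for [log_q n], the first threshold will force [N > N0] and the second
   [L <= (th + del) * (N - C)]. *)
have [L1 HL1] := ln_le_linear (th * N0.+1%:R) A1 ltr01.
have [L2 HL2] := ln_le_linear ((th + del) * C%:R) A2 B2.
pose Lm := Num.max 1 (Num.max L1 L2).
exists (Num.bound (sequences.expR (Lm * ln q%:R))) => n nn F mF szF h.
pose L := logb q%:R n%:R : R.
have n0 : 0 < n%:R :> R.
  by apply: lt_le_trans (expR_gt0 (Lm * ln q%:R)) _; apply: le_trans (ltW (archi_boundP (ltW (expR_gt0 _)))) _; rewrite ler_nat.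
have LmL : Lm <= L.
  rewrite /L /logb ler_pdivlMr // -ler_expR lnK ?posrE //.
  by apply: le_trans (ltW (archi_boundP (ltW (expR_gt0 _)))) _; rewrite ler_nat.
move: LmL; rewrite !ge_max => /and3P[L1L /HL1 h1 /HL2 h2].
have L0 : 0 < L by lra.
rewrite -/L; set x := n%:R / L => hx.
have x0 : 0 < x by rewrite divr_gt0.
(* This is the base-[q] logarithm of [x]. *)
pose Z := L - ln L / ln q%:R.
have lnx : ln x = Z * ln q%:R.
  rewrite /x ln_div ?posrE // /Z mulrBl divfK ?gt_eqF // /L /logb divfK ?gt_eqF //.
have hZ1 : th * N0.+1%:R <= Z by rewrite /Z; move: h1; lra.
have hZ2 : L + (th + del) * C%:R <= (1 + del / th) * Z.
  have -> : (1 + del / th) * Z =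
      L + del / th * L - (1 + del / th) / ln q%:R * ln L.
    by rewrite /Z; field; rewrite !gt_eqF.
  by lra.
have Z0 : 0 <= Z by apply: le_trans hZ1; rewrite mulr_ge0 // ltW.
(* For negative [h] the power [q ^ (h + 1)] is at most 1, yet it exceeds a nonnegative power of
   [x >= 1]. *)
have hpos : 0 <= h.
  rewrite leNgt; apply/negP => h0.
  have x1 : 1 <= x by rewrite -ler_ln ?posrE // ln1 lnx mulr_ge0 // ltW.
  have : (1 : R) < q%:R ^ (h + 1).
    apply: le_lt_trans hx; rewrite -[X in X <= _](powRr0 x) ler_powR //.
    by rewrite divr_ge0 // ltW.
  rewrite ltNge => /negP; apply; case: h h0 {hx} => // j _.
  have -> : Negz j + 1 = - (j%:Z) by rewrite NegzE -addn1 PoszD opprD addrNK.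
  rewrite -exprnN invf_le1 ?exprn_gt0 // exprn_ege1 //; lra.
have [m hm] : exists m : nat, h = m%:Z by case: h hpos {hx} => // m _; exists m.
pose N := m.+1.
have hN : q%:R ^ (h + 1) = q%:R ^+ N :> R by rewrite hm -PoszD addn1.
rewrite hN in hx.
(* If [h >= n] the interval contains the constant 1. *)
have [Nn|nN] := leqP N n; last first.
  exists 1; split; last by apply: kfree1; exact: ltnW.
  right; rewrite hm lez_nat; apply: (@leq_trans n) => //.
  suff : (size (F - 1)%R <= n.+1)%N by case: size.
  by rewrite (leq_trans (size_polyD _ _)) // size_polyN size_poly1 szF geq_max leqnn.
have lnN : Z < th * N%:R.
  move: hx; rewrite -ltr_ln ?posrE ?powR_gt0 ?exprn_gt0 // ln_powR lnx lnXn //.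
  rewrite -[ln _ *+ N]mulr_natl mulrA ltr_pM2r // mul1r mulrC ltr_pdivrMr //.
  by rewrite mulrC.
apply: contrapT => noQ.
have bad (v : 'rV[K]_N) : ~ kfree k (F + rVpoly v).
  move=> kf; apply: noQ; exists (F + rVpoly v); split=> //.
  rewrite /short_interval /= /deg_le opprD addrA subrr add0r size_polyN.
  right; rewrite hm lez_nat; have : (size (rVpoly v) <= N)%N by exact: size_rVpoly.
  by rewrite /N; case: size.
have N0N : (N0.+1 <= N)%N.
  rewrite -(ler_nat R) -(ler_pM2l th0); lra.
have [sCN NC CltN] := arith _ _ _ N0N.
have [||||l] := @not_kfree_count K p hp a (d a) k N n C F d0 dp dk _ _ _ _ bad.
- by rewrite szF.
- exact: leqW.
- exact: sCN.
- apply: (@leq_trans (2 * (N - C))); first exact: NC.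
  by rewrite leq_mul2r hk orbT.
rewrite hq -(ler_nat R) !natrM !natrX -/s natrB; last exact: ltnW.
move=> hl; rewrite -(ler_nat R) !natrD => hsum.
(* In logarithms: the number of values of D is at most [H^(1-theta)], and [H^theta] exceeds
   [n / L]. *)
have big : n%:R * q%:R ^+ digit_count N p a (d a) <= q%:R ^+ N * L.
  have e1 j : ln (n%:R * q%:R ^+ j) = ln n%:R + j%:R * ln q%:R :> R.
    by rewrite lnM ?posrE ?exprn_gt0 // lnXn // mulr_natl.
  have e2 : ln (q%:R ^+ N * L) = N%:R * ln q%:R + ln L.
    by rewrite lnM ?posrE ?exprn_gt0 // lnXn // mulr_natl.
  rewrite -ler_ln; last 2 first.
  - by rewrite posrE mulr_gt0 // exprn_gt0.
  - by rewrite posrE mulr_gt0 // exprn_gt0.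
  rewrite e1 e2.
  have := dc N; rewrite -(ler_pM2r lq0) => hJ.
  have : Z * ln q%:R <= th * N%:R * ln q%:R by rewrite ler_pM2r // ltW.
  rewrite -lnx /x ln_div ?posrE // => hxN; lra.
have NC0 : 0 < N%:R - C%:R :> R.
  by rewrite subr_gt0 ltr_nat.
(* The asymptotic lower bound [L / theta] for [N], with the loss of [C] absorbed by [del]. *)
have hLN : L <= (th + del) * (N%:R - C%:R).
  have h3 : (1 + del / th) * Z <= (1 + del / th) * (th * N%:R).
    by rewrite ler_pM2l ?ltW //; lra.
  have E : (1 + del / th) * (th * N%:R) = (th + del) * N%:R.
    by field; rewrite gt_eqF.
  rewrite E in h3; rewrite mulrBr; lra.
have s0 : 0 < s by lra.
have hl2 : l%:R <= q%:R ^+ N * ((th + del) / s).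
  rewrite mulrA ler_pdivlMr // -(ler_pM2r NC0).
  have h3 : q%:R ^+ N * L <= q%:R ^+ N * ((th + del) * (N%:R - C%:R)).
    by rewrite ler_pM2l ?exprn_gt0.
  have -> : l%:R * s * (N%:R - C%:R) = s * ((N%:R - C%:R) * l%:R) by ring.
  by rewrite -mulrA; exact: le_trans hl (le_trans big h3).
have := @sieve_sum_le R K k N (N - C) hk; rewrite hq => /(_ q2) small.
have CN : (C <= N)%N by exact: ltnW.
set QN : R := q%:R ^+ N in hl2 small *.
have QN0 : 0 < QN by rewrite exprn_gt0.
have QC : q%:R ^+ (N - C) = QN / q%:R ^+ C :> R.
  by rewrite /QN -{2}(subnK CN) exprD mulfK // gt_eqF // exprn_gt0.
rewrite QC in small.
have h5 : 3 * (QN / q%:R ^+ C) <= QN * del.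
  by rewrite mulrCA ler_pM2l.
have h6 : (th + del) / s <= th / s + del.
  by rewrite mulrDl lerD2l ler_pdivrMr // ler_peMr // ltW.
have h7 : QN * ((th + del) / s) <= QN * (th / s + del) by rewrite ler_pM2l.
have h8 : QN <= S * QN + 2 * (QN / q%:R ^+ C) + QN / q%:R ^+ C
    + QN * ((th + del) / s).
  apply: le_trans (lerD (lerD small (lexx _)) hl2).
  by move: hsum; rewrite !natrX QC.
have h9 : QN * (S + th / s + 2 * del) < QN.
  by rewrite gtr_pMr //; rewrite /del; lra.
have h10 : S * QN + 2 * (QN / q%:R ^+ C) + QN / q%:R ^+ C
    + QN * ((th + del) / s) <= QN * (S + th / s + 2 * del) by lra.
by have := le_lt_trans (le_trans h8 h10) h9; rewrite ltxx.
Qed.
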